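(* Let $A: C_{c}^{\infty}(G) \rightarrow \mathcal{F}(G)$ be a linear mapping satisfying the positive maximum principle, so that for all $f\in C_c^\infty(G)$, $\sigma\in G$, $$Af(\sigma) = -c(\sigma)f(\sigma) + \sum_{i=1}^{d}b_{i}(\sigma)X_{i}f(\sigma) + \sum_{j,k = 1}^{d}a_{jk}(\sigma)X_{j}X_{k}f(\sigma) + \int_{G}\left(f(\sigma \tau) - f(\sigma) - \sum_{i=1}^{d}x_{i}(\tau)X_{i}f(\sigma)\right)\mu(\sigma, d\tau),$$ where $c,b_i,a_{jk}:G\to\mathbb{R}$, $c\ge0$, $(a_{jk}(\sigma))$ is symmetric and non-negative definite for each $\sigma \in G$, and $\mu$ is a Lévy kernel. Suppose that (i) the functions $a_{ij}, b_k, c$ are continuous for all $i,j,k=1,\dots,d$; (ii) the mappings $g \mapsto \int_{U}h(\tau)\left(\sum_{i=1}^{d}x_{i}(\tau)^{2}\right)\mu(g, d\tau)$ are continuous on $G$ for all $h \in C_{b}(U)$, and the mappings $g \mapsto \int_{U^{c}}k(\tau)\mu(g, d\tau)$ are continuous on $G$ for all $k \in C_{b}(U^{c})$; (iii) $\lim_{\sigma\to\infty}\mu(\sigma,U^c)=0$. Then $A$ maps $C^\infty_c(G)$ to $C_0(G)$.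
   Context: $G$ is a Lie group of dimension $d$ with neutral element $e$, Lie algebra $\mathfrak{g}$, exponential map $\exp$ and Borel $\sigma$-algebra $\mathcal{B}(G)$. $\mathcal{F}(G)$ is the space of all real-valued functions on $G$, $C_0(G)$ the space of real-valued continuous functions vanishing at infinity, $C_c^\infty(G)$ the space of real-valued smooth compactly supported functions, and $C_b(Y)$ the space of bounded continuous real-valued functions on $Y$. The limit $\sigma\to\infty$ is in the sense of leaving compact sets. A basis $\{X_1,\dots,X_d\}$ of $\mathfrak{g}$ is fixed; elements $X\in\mathfrak{g}$ act on smooth functions as left-invariant vector fields, $Xf(\sigma)=\frac{d}{du}f(\sigma\exp(uX))|_{u=0}$. A canonical co-ordinate neighbourhood of $e$ is an open neighbourhood $U$ of $e$ together with co-ordinate functions $x_1,\dots,x_d\in C_c^\infty(G)$ such that $g\mapsto (x_1(g),\dots,x_d(g))$ is a diffeomorphism of $U$ onto an open neighbourhood of $0$ in $\mathbb{R}^d$, sending $e$ to $0$, and $g=\exp(\sum_{i=1}^d x_i(g)X_i)$ for $g\in U$. One such $U$ with functions $x_1,\dots,x_d$ is fixed. Positive maximum principle for $A$: whenever $f \in C_{c}^{\infty}(G)$ and $\rho\in G$ satisfy $f(\rho) = \sup_{\tau \in G}f(\tau) \geq 0$, then $Af(\rho) \leq 0$. A Borel measure $\mu$ on $G$ is a Lévy measure if $\mu(\{e\})=0$ and, for every canonical co-ordinate neighbourhood $U$ of $e$, $\int_U \sum_{i=1}^d x_i(g)^2\,\mu(dg)<\infty$ and $\mu(U^c)<\infty$.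 A Lévy kernel is a mapping $\mu:G\times\mathcal{B}(G)\to[0,\infty]$ with $\mu(g,\cdot)$ a Lévy measure for every $g\in G$. *)

(* Defs.v *)
From HB Require Import structures.
From mathcomp Require Import all_boot all_order all_algebra.
From mathcomp Require Import all_classical all_reals all_analysis.

Set Implicit Arguments.
Unset Strict Implicit.
Unset Printing Implicit Defensive.

Import Order.TTheory GRing.Theory Num.Theory.
Import numFieldNormedType.Exports.

Local Open Scope classical_set_scope.
Local Open Scope ring_scope.

(* [Ck n O f]: all partial derivatives of [f] of order at most [n] exist and
   are continuous on the (open) set [O]. *)
Fixpoint Ck (R : realType) (m n : nat) (O : set 'rV[R]_m)
    (f : 'rV[R]_m -> R) : Prop :=
  (forall z, O z -> {for z, continuous f}) /\
  (if n is k.+1 then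
     forall i : 'I_m,
       (forall z, O z -> derivable f z (delta_mx 0 i)) /\
       Ck k O (fun z => 'D_(delta_mx 0 i) f z)
   else True).

Definition smooth_on (R : realType) (m : nat) (O : set 'rV[R]_m)
    (f : 'rV[R]_m -> R) : Prop :=
  forall n, Ck n O f.

Definition smooth_map_on (R : realType) (m p : nat) (O : set 'rV[R]_m)
    (F : 'rV[R]_m -> 'rV[R]_p) : Prop :=
  forall j : 'I_p, smooth_on O (fun z => F z 0 j).

(* [cmap] only matters on [cdom], and [cinv] only on [cmap @` cdom]. *)
Record chart (R : realType) (d : nat) (M : Type) := Chart {
  cdom : set M ;
  cmap : M -> 'rV[R]_d ;
  cinv : 'rV[R]_d -> M
}.

Definition is_chart (R : realType) (d : nat) (M : topologicalType)
    (k : chart R d M) : Prop :=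
  [/\ open (cdom k),
      open (cmap k @` cdom k),
      (forall p, cdom k p -> cinv k (cmap k p) = p),
      (forall p, cdom k p -> {for p, continuous (cmap k)}) &
      (forall z, (cmap k @` cdom k) z -> {for z, continuous (cinv k)})].

Definition transition_smooth (R : realType) (d : nat) (M : Type)
    (k l : chart R d M) : Prop :=
  smooth_map_on (cmap k @` (cdom k `&` cdom l)) (cmap l \o cinv k).

(* [atlas] is any smooth atlas, not necessarily the maximal one.
   The base point is only there because the measurable types of the library
   are pointed. *)
HB.mixin Record isManifold (R : realType) (d : nat) M
    of PointedTopological M := {
  atlas : set (chart R d M) ;
  manifold_hausdorff : hausdorff_space M ;
  manifold_second_countable : @second_countable M ;
  atlas_chart : forall k, atlas k -> is_chart k ;
  atlas_cover : forall p : M, exists2 k, atlas k & cdom k p ;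
  atlas_compat : forall k l, atlas k -> atlas l -> transition_smooth k l
}.

#[short(type="manifoldType")]
HB.structure Definition Manifold (R : realType) (d : nat) :=
  {M of PointedTopological M & isManifold R d M}.

HB.mixin Record isLieGroup (R : realType) (d : nat) G
    of Group G & Manifold R d G := {
  lie_mul_continuous : continuous (fun p : G * G => (p.1 * p.2)%g) ;
  lie_inv_continuous : continuous (fun g : G => g^-1%g) ;
  lie_mul_smooth : forall k1 k2 k3 : chart R d G,
    atlas k1 -> atlas k2 -> atlas k3 ->
    smooth_map_on
      [set w : 'rV[R]_(d + d) | exists g h,
         [/\ cdom k1 g, cdom k2 h, cdom k3 (g * h)%g &
             w = row_mx (cmap k1 g) (cmap k2 h)]]
      (fun w => cmap k3 (cinv k1 (lsubmx w) * cinv k2 (rsubmx w))%g) ;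
  lie_inv_smooth : forall k1 k2 : chart R d G,
    atlas k1 -> atlas k2 ->
    smooth_map_on
      (cmap k1 @` (cdom k1 `&` [set g | cdom k2 g^-1%g]))
      (fun z => cmap k2 (cinv k1 z)^-1%g)
}.

#[short(type="lieGroupType")]
HB.structure Definition LieGroup (R : realType) (d : nat) :=
  {G of Group G & Manifold R d G & isLieGroup R d G}.

(* Membership in the maximal atlas: [cmap k] is a diffeomorphism of [cdom k]
   onto an open subset of R^d. *)
Definition smooth_chart (R : realType) (d : nat) (M : manifoldType R d)
    (k : chart R d M) : Prop :=
  is_chart k /\
  forall l, atlas l -> transition_smooth k l /\ transition_smooth l k.

Definition smooth (R : realType) (d : nat) (M : manifoldType R d)
    (f : M -> R) : Prop :=
  forall k : chart R d M, atlas k ->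
    smooth_on (cmap k @` cdom k) (f \o cinv k).

Definition Cc_infty (R : realType) (d : nat) (M : manifoldType R d)
    : set (M -> R) :=
  [set f | smooth f /\ compact (closure [set p | f p != 0])].

Definition at_infinity (T : topologicalType) : set_system T :=
  filter_from compact (fun K => ~` K).

Global Instance at_infinity_filter (T : topologicalType) :
  Filter (@at_infinity T).
Proof.
apply: filter_from_filter; first by exists set0; exact: compact0.
move=> K L cK cL; exists (K `|` L); first exact: compactU.
by rewrite setCU.
Qed.

Definition C_0 (R : realType) (T : topologicalType) : set (T -> R) :=
  [set f | continuous f /\ f s @[s --> @at_infinity T] --> (0 : R)].

(* C_b(Y), a function on Y being represented by any extension to T. *)
Definition C_b (R : realType) (T : topologicalType) (Y : set T)
    : set (T -> R) :=
  [set h | {within Y, continuous h} /\ [bounded h t | t in Y]].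

Definition linear_on (R : realType) (T : Type) (D : set (T -> R))
    (A : (T -> R) -> (T -> R)) : Prop :=
  forall (a : R) f h, D f -> D h -> A (a *: f + h) = a *: A f + A h.

(* Left-invariant vector fields, as derivations of the algebra of smooth
   functions commuting with left translations. The value 0 outside smooth
   functions is a normalisation: two fields that agree on smooth functions are
   then equal, so linear combinations can be taken in the ambient real vector
   space of operators. *)
Definition lie_algebra (R : realType) (d : nat) (G : lieGroupType R d)
    : set ((G -> R) -> (G -> R)) :=
  [set X |
    [/\ (forall f, smooth f -> smooth (X f)),
        linear_on [set f | smooth f] X,
        (forall f h, smooth f -> smooth h ->
           X (fun s => f s * h s) = (fun s => f s * X h s + h s * X f s)),
        (forall (s : G) f, smooth f ->
           X (fun t => f (s * t)%g) = (fun t => X f (s * t)%g)) &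
        (forall f, ~ smooth f -> X f = 0)]].

Definition lie_algebra_basis (R : realType) (d : nat) (G : lieGroupType R d)
    (X : 'I_d -> (G -> R) -> (G -> R)) : Prop :=
  [/\ (forall i, lie_algebra (X i)),
      (forall v : 'I_d -> R, \sum_i v i *: X i = 0 -> forall i, v i = 0) &
      (forall Y, lie_algebra Y -> exists v : 'I_d -> R, Y = \sum_i v i *: X i)].

(* For X in the Lie algebra, u |-> exp (u X) is the one-parameter subgroup with
   X f (s) = d/du f (s exp (u X)) at u = 0 (a continuous one-parameter subgroup
   is smooth). Every Lie group has such a map, it is unique on the Lie algebra,
   and its values elsewhere are irrelevant. *)
Definition exponential_map (R : realType) (d : nat) (G : lieGroupType R d)
    (expo : ((G -> R) -> (G -> R)) -> G) : Prop :=
  forall X, lie_algebra X ->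
    [/\ (forall u v : R,
           expo ((u + v) *: X) = (expo (u *: X) * expo (v *: X))%g),
        continuous (fun u : R => expo (u *: X)) &
        (forall f (s : G), smooth f ->
           is_derive (0 : R) 1 (fun u : R => f (s * expo (u *: X))%g)
             (X f s))].

Definition canonical_nbhd (R : realType) (d : nat) (G : lieGroupType R d)
    (expo : ((G -> R) -> (G -> R)) -> G) (X : 'I_d -> (G -> R) -> (G -> R))
    (U : set G) (x : 'I_d -> G -> R) : Prop :=
  [/\ open U /\ U 1%g,
      (forall i, Cc_infty (x i)),
      (exists psi : 'rV[R]_d -> G,
         smooth_chart (Chart U (fun g => \row_i x i g) psi)),
      (forall i, x i 1%g = 0) &
      (forall g, U g -> g = expo (\sum_i x i g *: X i))].

Definition borel (T : ptopologicalType) := g_sigma_algebraType (@open T).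

Definition levy_measure (R : realType) (d : nat) (G : lieGroupType R d)
    (expo : ((G -> R) -> (G -> R)) -> G) (X : 'I_d -> (G -> R) -> (G -> R))
    (mu : {measure set (borel G) -> \bar R}) : Prop :=
  mu [set 1%g] = 0%E /\
  forall (U : set G) (x : 'I_d -> G -> R), canonical_nbhd expo X U x ->
    (\int[mu]_(g in U) (\sum_i x i g ^+ 2)%:E < +oo)%E /\
    (mu (~` U) < +oo)%E.

Definition positive_maximum_principle (R : realType) (d : nat)
    (G : lieGroupType R d) (A : (G -> R) -> (G -> R)) : Prop :=
  forall f (rho : G), Cc_infty f ->
    f rho = sup (range f) -> 0 <= f rho -> A f rho <= 0.

(* Main.v *)
(** On [U] write [t = exp Y] with [Y = sum_i x_i(t) X_i]. Two applications of
    the mean value theorem to [u |-> f (s exp (u Y))] bound the jump integrand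
    [J_s(t)] by a constant times [r(t) = sum_i x_i(t)^2], and, applied to
    [u |-> f (s' exp (u Y)) - f (s exp (u Y))], bound [J_s' - J_s] by [eps * r]
    for [s'] near [s], because the translates of the compactly supported
    functions [X_i X_j f] depend continuously on [s] in the sup norm.
    The ratio [J_s / r] is bounded on [U] but in general has no limit at the
    neutral element, so it is not an admissible test function in hypothesis
    (ii). It is replaced by [J_s / max(r, eps)], which is; the error is at most
    a constant times the integral of [r - r^2 / max(r, eps)], which is
    continuous in [s] and tends to 0 with [eps] by dominated convergence.
    At infinity the local part vanishes off the support [K] of [f], the integral
    over [U] vanishes off [K U^-1], which is relatively compact since [U] is
    covered by [{e}] and the supports of the [x_i], and the integral over the
    complement of [U] is bounded by [sup |f| * mu(s, U^c)]. *)
Require Import Defs.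
From HB Require Import structures.
From mathcomp Require Import all_boot all_order all_algebra.
From mathcomp Require Import all_classical all_reals all_analysis.
From mathcomp Require Import measurable_realfun ring lra.

Set Implicit Arguments.
Unset Strict Implicit.
Unset Printing Implicit Defensive.

Import Order.TTheory GRing.Theory Num.Theory.
Import numFieldNormedType.Exports.

Local Open Scope classical_set_scope.
Local Open Scope ring_scope.

(** * Functions of class C^n on open subsets of R^m *)

Lemma near_eq_continuous (T V : topologicalType) (f g : T -> V) (p : T) :
  (\near p, f p = g p) -> {for p, continuous f} -> {for p, continuous g}.
Proof.
move=> fg cf; rewrite /prop_for /continuous_at -(nbhs_singleton fg).
by apply: cvg_trans cf; apply: near_eq_cvg; apply: filterS fg => q ->.
Qed.

(** As [O] is open, equality on [O] is equality near each of its points, which is all that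
    continuity and derivatives see. This serves where a formula for a derivative is known only on
    [O], as for linear combinations. *)
Lemma Ck_eq (R : realType) (m n : nat) (O : set 'rV[R]_m)
    (f g : 'rV[R]_m -> R) :
  open O -> {in O, f =1 g} -> Ck n O f -> Ck n O g.
Proof.
move=> oO.
have near_eq (u v : 'rV[R]_m -> R) : {in O, u =1 v} ->
    forall z, O z -> \near z, u z = v z.
  move=> uv z Oz; apply: filterS (open_nbhs_nbhs (conj oO Oz)) => y Oy.
  by apply: uv; rewrite inE.
elim: n f g => [|n IHn] f g fg /= [cf Df].
  by split=> // z Oz; apply: near_eq_continuous (cf z Oz); exact: near_eq.
split=> [z Oz|i].
  by apply: near_eq_continuous (cf z Oz); exact: near_eq.
have [df Ckf] := Df i; split=> [z Oz|].
  exact: near_eq_derivable (near_eq _ _ fg z Oz) (df z Oz).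
apply: IHn Ckf => z; rewrite inE => Oz.
exact: near_eq_derive (near_eq _ _ fg z Oz).
Qed.

Lemma Ck_lin (R : realType) (m n : nat) (O : set 'rV[R]_m) (a : R)
    (f g : 'rV[R]_m -> R) :
  open O -> Ck n O f -> Ck n O g -> Ck n O (a *: f + g).
Proof.
move=> oO.
have cont (u v : 'rV[R]_m -> R) z : {for z, continuous u} ->
    {for z, continuous v} -> {for z, continuous (a *: u + v)}.
  by move=> cu cv; exact: (cvgD (continuousZl_tmp (k := a) cu) cv).
elim: n f g => [|n IHn] f g /= [cf Df] [cg Dg].
  by split=> [z Oz|//]; apply: cont; [exact: cf|exact: cg].
split=> [z Oz|i]; first by apply: cont; [exact: cf|exact: cg].
have [df Ckf] := Df i; have [dg Ckg] := Dg i; split=> [z Oz|].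
  by apply: derivableD; [apply: derivableZ; exact: df|exact: dg].
apply: Ck_eq (IHn _ _ Ckf Ckg) => // z; rewrite inE => Oz.
rewrite (deriveD (f := a *: f)); last exact: dg.
  by rewrite deriveZ//; exact: df.
by apply: derivableZ; exact: df.
Qed.

Lemma Ck0 (R : realType) (m n : nat) (O : set 'rV[R]_m) :
  Ck n O (fun=> 0 : R).
Proof.
elim: n => [|n IHn] /=; split=> //; try by move=> z _; exact: cst_continuous.
move=> i; split=> [z _|]; first exact: derivable_cst.
rewrite [X in Ck _ _ X](_ : _ = (fun=> 0))//.
by apply/funext => z; rewrite derive_cst.
Qed.

(** * Smooth functions and the Lie algebra *)

Section SmoothFunctions.
Variables (R : realType) (d : nat) (M : manifoldType R d).
Implicit Types f g : M -> R.

Lemma smooth0 : smooth (0 : M -> R).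
Proof. by move=> k _ n; exact: Ck0. Qed.

Lemma smooth_lin (a : R) f g : smooth f -> smooth g -> smooth (a *: f + g).
Proof.
move=> sf sg k ak n; have [_ ok _ _ _] := atlas_chart k ak.
by apply: (@Ck_lin R d n _ a (f \o cinv k) (g \o cinv k) ok);
  [exact: sf|exact: sg].
Qed.

Lemma smooth_continuous f : smooth f -> continuous f.
Proof.
move=> sf p; have [k ak kp] := atlas_cover p.
have [ok _ ki cm _] := atlas_chart k ak.
have [cf _] := sf k ak 0%N.
apply: (near_eq_continuous (f := (f \o cinv k) \o cmap k)).
  by apply: filterS (open_nbhs_nbhs (conj ok kp)) => q kq /=; rewrite ki.
by apply: continuous_comp; [exact: cm|apply: cf; exists p].
Qed.

End SmoothFunctions.

Section LieAlgebra.
Variables (R : realType) (d : nat) (G : lieGroupType R d).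
Implicit Types (f : G -> R) (Y Z : (G -> R) -> (G -> R)).

Lemma lie_algebra_lin (a : R) Y Z :
  lie_algebra Y -> lie_algebra Z -> lie_algebra (a *: Y + Z).
Proof.
move=> [Ysm Ylin Yder Yinv Y0] [Zsm Zlin Zder Zinv Z0]; split.
- move=> f sf; exact: smooth_lin (Ysm f sf) (Zsm f sf).
- move=> c f h sf sh; apply/funext => s.
  have /= -> : (a *: Y + Z) (c *: f + h) s
    = a * Y (c *: f + h) s + Z (c *: f + h) s by [].
  rewrite (Ylin _ _ _ sf sh) (Zlin _ _ _ sf sh).
  have -> : (c *: (a *: Y + Z) f + (a *: Y + Z) h) s
    = c * (a * Y f s + Z f s) + (a * Y h s + Z h s) by [].
  have -> : (c *: Y f + Y h) s = c * Y f s + Y h s by [].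
  have -> : (c *: Z f + Z h) s = c * Z f s + Z h s by [].
  ring.
- move=> f h sf sh; apply/funext => s.
  have -> : (a *: Y + Z) (fun s => f s * h s) s
    = a * Y (fun s => f s * h s) s + Z (fun s => f s * h s) s by [].
  rewrite (Yder _ _ sf sh) (Zder _ _ sf sh).
  have -> k : (a *: Y + Z) k s = a * Y k s + Z k s by [].
  have -> k : (a *: Y + Z) k s = a * Y k s + Z k s by [].
  ring.
- move=> s f sf; apply/funext => t.
  have -> k u : (a *: Y + Z) k u = a * Y k u + Z k u by [].
  have -> k u : (a *: Y + Z) k u = a * Y k u + Z k u by [].
  by rewrite (Yinv _ _ sf) (Zinv _ _ sf).
- move=> f nsf; apply/funext => t.
  have -> k u : (a *: Y + Z) k u = a * Y k u + Z k u by [].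
  by rewrite (Y0 _ nsf) (Z0 _ nsf) mulr0 addr0.
Qed.

Lemma lie_algebra_sum n (v : 'I_n -> R) (Y : 'I_n -> (G -> R) -> (G -> R)) :
  (forall i, lie_algebra (Y i)) -> lie_algebra (\sum_i v i *: Y i).
Proof.
move=> lY; elim/big_rec: _ => [|i Z _ lZ]; last exact: lie_algebra_lin.
(* The empty sum remains: the zero operator satisfies the five conditions. *)
split.
- by move=> f _; exact: smooth0.
- move=> a f h _ _; apply/funext => s.
  by rewrite -[RHS]/(a * 0 + 0) mulr0 addr0.
- move=> f h _ _; apply/funext => s.
  by rewrite -[RHS]/(f s * 0 + h s * 0) !mulr0 addr0.
- by [].
- by [].
Qed.

Lemma sum_operatorE n (v : 'I_n -> R) (Y : 'I_n -> (G -> R) -> (G -> R)) f s :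
  (\sum_i v i *: Y i) f s = \sum_i v i * Y i f s.
Proof.
elim/big_rec2: _ => // i y Z _ <-.
by [].
Qed.

Lemma lie_algebra_linear_sum n (v : 'I_n -> R) (f : 'I_n -> G -> R) Y :
  lie_algebra Y -> (forall i, smooth (f i)) ->
  Y (\sum_i v i *: f i) = \sum_i v i *: Y (f i).
Proof.
move=> [_ Ylin _ _ _] sf.
suff [] : smooth (\sum_i v i *: f i) /\
   Y (\sum_i v i *: f i) = \sum_i v i *: Y (f i) by [].
elim/big_rec2: _ => [|i g h _ [sh <-]]; last first.
  by split; [exact: smooth_lin|exact: (Ylin _ _ _ (sf i) sh)].
split; first exact: smooth0.
(* The empty sum needs [Y 0 = 0], which follows by cancellation from [Y 0 = Y 0 + Y 0]. *)
have := Ylin 1 0 0 (@smooth0 _ _ G) (@smooth0 _ _ G).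
rewrite !scale1r addr0 => /(congr1 (fun u => u - Y 0)).
by rewrite subrr addrK.
Qed.

End LieAlgebra.

(** * Second order estimates along the exponential map *)

(** The mean value theorem gives [p 1 - p 0 = p' a] with [a] in [0, 1], and then
    [p' a - p' 0 = p'' b * a]. The factor 1/2 of Taylor's formula is lost, which is harmless
    here. *)
Lemma taylor1_bound (R : realType) (p p' p'' : R -> R) (C : R) :
  (forall u : R, is_derive u 1 p (p' u)) ->
  (forall u : R, is_derive u 1 p' (p'' u)) ->
  (forall u, `|p'' u| <= C) -> `|p 1 - p 0 - p' 0| <= C.
Proof.
move=> dp dp' leC.
have cont (q q' : R -> R) : (forall u : R, is_derive u 1 q (q' u)) ->
    forall a b, {within `[a, b], continuous q}.
  move=> dq a b; apply: derivable_within_continuous => u _.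
  by have [] := dq u.
have [a /itvP a01 ->] := MVT_segment ler01 (fun u _ => dp u) (cont _ _ dp 0 1).
have a0 : 0 <= a by rewrite a01.
have [b _] := MVT_segment a0 (fun u _ => dp' u) (cont _ _ dp' 0 a).
rewrite !subr0 mulr1 => ->; rewrite normrM (ger0_norm a0).
by rewrite (le_trans _ (leC b))// ler_piMr// a01.
Qed.

Lemma quadratic_form_bound (R : realType) n (v : 'I_n -> R)
    (c : 'I_n -> 'I_n -> R) (C : R) :
  (forall i j, `|c i j| <= C) ->
  `|\sum_i v i * \sum_j v j * c i j| <= C * n%:R ^+ 2 * \sum_i v i ^+ 2.
Proof.
move=> cC; pose r := \sum_i v i ^+ 2.
have vr i : v i ^+ 2 <= r.
  by rewrite /r (bigD1 i)//= lerDl sumr_ge0// => j _; exact: sqr_ge0.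
have vv i j : `|v i| * `|v j| <= r.
  (* Expanding the square of [|v i| - |v j|] gives 2 |v_i| |v_j| <= v_i^2 + v_j^2 <= 2 r. *)
  have := vr i; have := vr j; rewrite -[v i ^+ 2]real_normK ?num_real//.
  rewrite -[v j ^+ 2]real_normK ?num_real//.
  have := sqr_ge0 (`|v i| - `|v j|); nra.
have -> : C * n%:R ^+ 2 * r = \sum_(i < n) \sum_(j < n) C * r.
  by rewrite !sumr_const card_ord -mulrnA -[RHS]mulr_natr natrM; ring.
apply: le_trans (ler_norm_sum _ _ _) _; apply: ler_sum => i _.
rewrite mulr_sumr; apply: le_trans (ler_norm_sum _ _ _) _.
apply: ler_sum => j _; rewrite mulrA !normrM mulrC.
by apply: ler_pM => //; exact: mulr_ge0.
Qed.

Lemma continuous_mulg (R : realType) (d : nat) (G : lieGroupType R d)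
    (T : topologicalType) (f g : T -> G) (p : T) :
  {for p, continuous f} -> {for p, continuous g} ->
  {for p, continuous (fun q => (f q * g q)%g)}.
Proof.
move=> cf cg.
apply: (@continuous_comp _ _ _ (fun q => (f q, g q)) (fun u => (u.1 * u.2)%g)).
  exact: (cvg_pair cf cg).
exact: lie_mul_continuous.
Qed.

Lemma continuous_invg (R : realType) (d : nat) (G : lieGroupType R d)
    (T : topologicalType) (f : T -> G) (p : T) :
  {for p, continuous f} -> {for p, continuous (fun q => (f q)^-1%g)}.
Proof.
by move=> cf; apply: (continuous_comp cf); exact: lie_inv_continuous.
Qed.

Section Exponential.
Variables (R : realType) (d : nat) (G : lieGroupType R d).
Variable expo : ((G -> R) -> (G -> R)) -> G.
Hypothesis hexpo : exponential_map expo.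
Implicit Types (f : G -> R) (Y : (G -> R) -> (G -> R)).

Lemma expo0 Y : lie_algebra Y -> expo (0 *: Y) = 1%g.
Proof.
move=> /hexpo[expoD _ _]; apply: (mulgI (expo (0 *: Y))).
by rewrite -expoD addr0 mulg1.
Qed.

(** [exponential_map] gives the derivative at time 0 only. By the one-parameter group law, time [u]
    from [s] is time 0 from the base point [s exp (u Y)]. *)
Lemma is_derive_expo Y f s (u : R) : lie_algebra Y -> smooth f ->
  is_derive u 1 (fun v => f (s * expo (v *: Y))%g) (Y f (s * expo (u *: Y))%g).
Proof.
move=> lY sf; have [expoD _ dY] := hexpo lY.
pose h (w : R) := f (s * expo (u *: Y) * expo (w *: Y))%g.
have -> : (fun v => f (s * expo (v *: Y))%g) = h \o shift (- u).
  by apply/funext => v; rewrite /h /= -mulgA -expoD addrC subrK.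
rewrite -[Y f _]mulr1; apply: is_derive1_comp; last exact: is_derive_shift.
by rewrite /= subrr; exact: dY.
Qed.

(** Elements of the Lie algebra are operators on global functions, so locality is not built in. It
    holds because [Y f s] is a derivative along a continuous curve through [s], and so depends only
    on [f] near [s]. *)
Lemma lie_algebra_local Y f s : lie_algebra Y -> smooth f ->
  (\near s, f s = 0) -> Y f s = 0.
Proof.
move=> lY sf f0; have [_ cY dY] := hexpo lY.
have cs : {for (0 : R), continuous (fun u : R => (s * expo (u *: Y))%g)}.
  by apply: continuous_mulg; [exact: cst_continuous|exact: cY].
have E : \forall u \near (0 : R), f (s * expo (u *: Y))%g = cst 0 u.
  by apply: (cs [set t | f t = 0]); rewrite expo0// mulg1; exact: f0.
have dY0 := near_eq_is_derive E (dY f s sf).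
rewrite -(@derive_val _ _ _ _ _ _ _ dY0).
exact: derive_cst.
Qed.

(** The conclusion has the form of the hypothesis on [f], with the same [K]; iterating it confines
    X_i f and X_i X_j f to the support of [f]. *)
Lemma lie_algebra_support Y f (K : set G) : lie_algebra Y -> smooth f ->
  closed K -> (forall s, ~ K s -> f s = 0) -> forall s, ~ K s -> Y f s = 0.
Proof.
move=> lY sf clK fK s nKs; apply: lie_algebra_local => //.
by apply: filterS (open_nbhs_nbhs (conj (closed_openC clK) nKs)) => t /fK.
Qed.

Variables (X : 'I_d -> (G -> R) -> (G -> R)).
Hypothesis lX : forall i, lie_algebra (X i).

(* [(a, b) = (1, 0)] is the Taylor bound for one translate of [f], and
   [(a, b) = (1, 1)] the bound for the difference of two translates. *)
Lemma taylor_translates f (v : 'I_d -> R) (a b : R) s s' t C : smooth f ->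
  t = expo (\sum_i v i *: X i) ->
  (forall i j u,
     `|a * X i (X j f) (s * u)%g - b * X i (X j f) (s' * u)%g| <= C) ->
  `|(a * f (s * t)%g - b * f (s' * t)%g) - (a * f s - b * f s')
     - \sum_i v i * (a * X i f s - b * X i f s')|
   <= C * d%:R ^+ 2 * \sum_i v i ^+ 2.
Proof.
move=> sf -> HC; pose Y := \sum_i v i *: X i.
have lY : lie_algebra Y by exact: lie_algebra_sum.
have sXf i : smooth (X i f) by have [+ _ _ _ _] := lX i; exact.
have sYf : smooth (Y f) by have [+ _ _ _ _] := lY; exact.
have Yf : Y f = \sum_i v i *: X i f.
  apply/funext => g; rewrite /Y sum_operatorE.
  by elim/big_rec2: _ => // i y z _ ->.
have YYf g : Y (Y f) g = \sum_i v i * \sum_j v j * X i (X j f) g.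
  rewrite /Y sum_operatorE; apply: eq_bigr => i _; congr (_ * _).
  rewrite -/Y Yf lie_algebra_linear_sum//.
  by elim/big_rec2: _ => // j y z _ <-.
(* Differentiating [p k] in [u] replaces [k] by [Y k], so [p f], [p (Y f)] and [p (Y (Y f))] are the
   three functions of [taylor1_bound]. *)
pose p k (u : R) :=
  a * k (s * expo (u *: Y))%g - b * k (s' * expo (u *: Y))%g : R.
have dp k u : smooth k -> is_derive (u : R) 1 (p k) (p (Y k) u).
  move=> sk; apply: is_deriveB.
    exact: (is_deriveZ a (is_derive_expo s u lY sk)).
  exact: (is_deriveZ b (is_derive_expo s' u lY sk)).
have := @taylor1_bound R (p f) (p (Y f)) (p (Y (Y f)))
  (C * d%:R ^+ 2 * \sum_i v i ^+ 2) (fun u => dp f u sf)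
  (fun u => dp (Y f) u sYf).
rewrite /p !expo0// !mulg1 !scale1r.
have -> : a * Y f s - b * Y f s' =
    \sum_i v i * (a * X i f s - b * X i f s').
  rewrite /Y !sum_operatorE !mulr_sumr -sumrB; apply: eq_bigr => i _; ring.
apply=> u; rewrite !YYf.
(* The second derivative is the quadratic form in [v] with coefficients [q i j], each bounded by
   [C]. *)
set q := fun i j => a * X i (X j f) (s * expo (u *: Y))%g
   - b * X i (X j f) (s' * expo (u *: Y))%g.
rewrite [X in `|X|](_ : _ = \sum_i v i * \sum_j v j * q i j).
  by apply: quadratic_form_bound => i j; exact: HC.
rewrite !mulr_sumr -sumrB; apply: eq_bigr => i _.
by rewrite !mulr_sumr -sumrB; apply: eq_bigr => j _; rewrite /q; ring.
Qed.

End Exponential.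

(** * Functions of compact support *)

Lemma notin_closure_support (R : realType) (T : topologicalType)
    (f : T -> R) (t : T) : ~ closure [set p | f p != 0] t -> f t = 0.
Proof.
by move=> nt; apply: contrapT => /eqP ft; apply: nt; exact: subset_closure.
Qed.

Lemma compact_support_bounded (R : realType) (T : topologicalType)
    (g : T -> R) (K : set T) :
  continuous g -> compact K -> (forall t, ~ K t -> g t = 0) ->
  exists C, forall t, `|g t| <= C.
Proof.
move=> cg cK gK.
have /compact_bounded[M [_ HM]] : compact (g @` K).
  by apply: continuous_compact => //; exact: continuous_subspaceT.
exists (`|M| + 1) => t; have [Kt|/gK ->] := pselect (K t); last first.
  by rewrite normr0 addr_ge0.
by apply: HM; [rewrite ltr_pwDr// ler_norm|exists t].
Qed.

(** The supremum over the whole group reduces to a compact set: if neither [s0 t] nor [s t] lies in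
    [K], both values are 0; otherwise the one that does is called [k], and the other is a continuous
    function of [k] and [s] that equals [k] at [s = s0]. *)
Lemma translate_equicontinuous (R : realType) (d : nat) (G : lieGroupType R d)
    (g : G -> R) (K : set G) (s0 : G) (e : R) :
  continuous g -> compact K -> (forall t, ~ K t -> g t = 0) -> 0 < e ->
  \forall s \near s0, forall t, `|g (s * t)%g - g (s0 * t)%g| <= e.
Proof.
move=> cg /compact_near_coveringP cK gK e0.
(* [m (k, s)] stands for the other point. The difference is continuous and vanishes at [(k, s0)], so
   each [k] has a neighbourhood that works for all [s] near [s0]; compactness makes this uniform in
   [k]. *)
have cov (m : G * G -> G) : continuous m -> (forall k, m (k, s0) = k) ->
    \forall s \near s0, K `<=` [set k | `|g k - g (m (k, s))| <= e].
  move=> cm m0; apply: cK => k _.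
  have cd : {for (k, s0), continuous (fun q : G * G => g q.1 - g (m q))}.
    apply: cvgB; first by apply: continuous_comp; [exact: cvg_fst|exact: cg].
    by apply: continuous_comp; [exact: cm|exact: cg].
  have := @cvgr_norm_le _ _ _ _ _ _ _ cd e.
  by rewrite /= m0 subrr normr0 => /(_ _ e0); apply: filterS => -[].
have right_s : \forall s \near s0,
    K `<=` [set k | `|g k - g (s * (s0^-1 * k))%g| <= e].
  apply: (cov (fun q => q.2 * (s0^-1 * q.1))%g) => [q|k /=]; last first.
    by rewrite mulVKg.
  apply: continuous_mulg; first exact: cvg_snd.
  by apply: continuous_mulg; [exact: cst_continuous|exact: cvg_fst].
have right_s0 : \forall s \near s0,
    K `<=` [set k | `|g k - g (s0 * (s^-1 * k))%g| <= e].
  apply: (cov (fun q => s0 * (q.2^-1 * q.1))%g) => [q|k /=]; last first.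
    by rewrite mulVKg.
  apply: (@continuous_mulg _ _ G _ (cst s0) (fun q : G * G => q.2^-1 * q.1)%g).
    exact: cst_continuous.
  apply: continuous_mulg; last exact: cvg_fst.
  by apply: continuous_invg; exact: cvg_snd.
apply: filterS2 right_s right_s0 => s Ks Ks0 t.
have [K0t|nK0t] := pselect (K (s0 * t)%g).
  by have := Ks _ K0t; rewrite /= mulKg distrC.
have [Kst|nKst] := pselect (K (s * t)%g).
  by have := Ks0 _ Kst; rewrite /= mulKg.
by rewrite !gK// subrr normr0 ltW.
Qed.

(** * Integrals against a kernel *)

Lemma continuous_borel_measurable (R : realType) (T : ptopologicalType)
    (f : T -> R) (D : set (borel T)) :
  continuous f -> measurable_fun D (f : borel T -> R).
Proof.
move=> /continuousP cf; apply: measurable_funTS.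
apply: (measurability _ (RGenOpens.measurableE R)).
move=> _ [_ [a [b ->] <-]]; rewrite setTI.
by apply: sub_sigma_algebra; apply: cf; exact: interval_open.
Qed.

Lemma le_dist_Rintegral d (T : measurableType d) (R : realType)
    (mu : {measure set T -> \bar R}) (D : set T) (f g u : T -> R) :
  measurable D -> mu.-integrable D (EFin \o f) ->
  mu.-integrable D (EFin \o g) -> mu.-integrable D (EFin \o u) ->
  (forall t, D t -> `|f t - g t| <= u t) ->
  `|\int[mu]_(t in D) f t - \int[mu]_(t in D) g t| <= \int[mu]_(t in D) u t.
Proof.
move=> mD intf intg intu fgu; rewrite -RintegralB//.
have intfg : mu.-integrable D (EFin \o (fun t => f t - g t)).
  exact: (integrableB mD intf intg).
apply: le_trans (le_normr_Rintegral mD intfg) _; apply: le_Rintegral => //.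
exact: (integrable_abse intfg).
Qed.

(* Weak continuity of the finite measures [r dmu_s] suffices although [F s / r]
   need not be continuous where [r] vanishes, because [r dmu_s] does not charge
   the zeros of [r]. *)
Section KernelContinuity.
Variables (R : realType) (S : topologicalType) (T : ptopologicalType).
Variable mu : S -> {measure set (borel T) -> \bar R}.
Variables (D : set T) (r : T -> R).
Hypothesis mD : measurable (D : set (borel T)).
Hypothesis cr : continuous r.
Hypothesis r0 : forall t, 0 <= r t.
Hypothesis int_r : forall s, (\int[mu s]_(t in D) (r t)%:E < +oo)%E.

Lemma integrable_dominated s (f : T -> R) C : continuous f ->
  (forall t, D t -> `|f t| <= C * r t) -> (mu s).-integrable D (EFin \o f).
Proof.
move=> cf fC; have intr : (mu s).-integrable D (EFin \o r).
  apply/integrableP; split.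
    by apply/measurable_EFinP; exact: continuous_borel_measurable.
  under eq_integral do rewrite /= ger0_norm//.
  exact: int_r.
apply: (le_integrable mD _ _ (integrableZl mD C intr)).
  by apply/measurable_EFinP; exact: continuous_borel_measurable.
move=> t Dt /=; rewrite lee_fin (le_trans (fC t Dt))//; exact: ler_norm.
Qed.

(** What is lost from [r] when the quotient by [r] is replaced by the quotient by [max (r, e)]. It
    lies between 0 and [r] and vanishes where [r >= e]. *)
Let cut (e : R) t := r t - r t / Num.max (r t) e * r t.

Let max_gt0 (e : R) t : 0 < e -> 0 < Num.max (r t) e.
Proof. by move=> e0; rewrite lt_max e0 orbT. Qed.

Let ratio_le1 (e : R) t : 0 < e -> 0 <= r t / Num.max (r t) e <= 1.
Proof.
move=> e0; have m0 := max_gt0 t e0; rewrite divr_ge0 ?(ltW m0)//=.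
by rewrite ler_pdivrMr// mul1r le_max lexx.
Qed.

Let cut_ge0 (e : R) t : 0 < e -> 0 <= cut e t.
Proof.
move=> e0; have /andP[_ le1] := ratio_le1 t e0.
by rewrite /cut subr_ge0 ler_piMl.
Qed.

Let cut_le (e : R) t : 0 < e -> cut e t <= r t.
Proof.
move=> e0; have /andP[ge0 _] := ratio_le1 t e0.
by rewrite /cut gerBl mulr_ge0.
Qed.

Let cont_max (e : R) : continuous (fun t => Num.max (r t) e).
Proof.
by move=> t; apply: continuous_max; [exact: cr|exact: cst_continuous].
Qed.

Let continuous_quot (e : R) (f : T -> R) : 0 < e -> continuous f ->
  continuous (fun t => f t / Num.max (r t) e).
Proof.
move=> e0 cf t; apply: cvgM; first exact: cf.
by apply: cvgV; [rewrite gt_eqF// max_gt0|exact: cont_max].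
Qed.

Let continuous_cut (e : R) : 0 < e -> continuous (cut e).
Proof.
move=> e0 t; apply: cvgB; first exact: cr.
by apply: cvgM; [exact: continuous_quot|exact: cr].
Qed.

Let cut_small s (e : R) : 0 < e ->
  exists2 c, 0 < c & \int[mu s]_(t in D) cut c t <= e.
Proof.
move=> e0; pose c n : R := n.+1%:R^-1.
have c0 n : 0 < c n by rewrite invr_gt0.
have intcut n : (mu s).-integrable D (EFin \o cut (c n)).
  apply: (@integrable_dominated _ _ 1); first exact: continuous_cut.
  by move=> t _; rewrite ger0_norm ?mul1r ?cut_le ?cut_ge0.
have intr : (mu s).-integrable D (EFin \o r).
  by apply: (@integrable_dominated _ _ 1) => // t _; rewrite ger0_norm ?mul1r.
have mcut n : measurable_fun (D : set (borel T)) (EFin \o cut (c n)).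
  exact: measurable_int (intcut n).
have cvgcut : {ae mu s, forall t, D t ->
    (EFin \o cut (c n)) t @[n --> \oo] --> (cst 0%E t : \bar R)}.
  apply: aeW => t _; apply: cvg_near_cst.
  (* Where [r t = 0] the cut is 0 for every threshold; where [r t > 0] it is 0 once the threshold
     1/(n+1) is below [r t]. *)
  have := r0 t; rewrite le_eqVlt => /predU1P[rt|rt].
    by apply: nearW => n /=; rewrite /cut -rt mulr0 subr0.
  have := near_infty_natSinv_lt (PosNum rt); apply: filterS => n /ltW /= nr.
  by rewrite /cut /= max_l// divff ?gt_eqF// mul1r subrr.
have domcut : {ae mu s, forall t n, D t ->
    (`|(EFin \o cut (c n)) t| <= (EFin \o r) t)%E}.
  by apply: aeW => t n _; rewrite /= lee_fin ger0_norm ?cut_le ?cut_ge0.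
have [_ _] :=
  dominated_convergence mD mcut (measurable_cst _) cvgcut intr domcut.
rewrite integral0 => /fine_cvgP[_].
move=> /cvgrPdist_lt /(_ e e0) [n _ /(_ n (leqnn n)) /= ltn].
exists (c n) => //; move: ltn; rewrite sub0r normrN => /ltW.
exact/le_trans/ler_norm.
Qed.

Variable F : S -> T -> R.
Hypothesis cont_F : forall s, continuous (F s).
Hypothesis dom_F : forall s, exists C, forall t, D t -> `|F s t| <= C * r t.
Hypothesis unif_F : forall s (e : R), 0 < e ->
  \forall s' \near s, forall t, D t -> `|F s' t - F s t| <= e * r t.
Hypothesis cont_mu : forall h : T -> R, C_b D h ->
  continuous (fun s => \int[mu s]_(t in D) (h t * r t)).

Lemma kernel_integrable s : (mu s).-integrable D (EFin \o F s).
Proof. have [C HC] := dom_F s; exact: integrable_dominated HC. Qed.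

(** The integral of [F s] is compared with [H s], the integral of [h * r] for one fixed admissible
    [h] built from [F s0]. [H] is continuous by [cont_mu], and the error of the comparison is
    controlled at [s0] and near it. *)
Lemma kernel_integral_continuous :
  continuous (fun s => \int[mu s]_(t in D) F s t).
Proof.
move=> s0; apply/cvgrPdist_le => /= e e0.
have [C C0 FC] : exists2 C, 0 < C & forall t, D t -> `|F s0 t| <= C * r t.
  have [C HC] := dom_F s0; exists (`|C| + 1); first by rewrite ltr_wpDl.
  move=> t Dt; apply: le_trans (HC t Dt) _; apply: ler_wpM2r => //.
  by rewrite (le_trans (ler_norm C))// lerDl.
(* This makes [C * W s0] at most e/8; letting [W] vary by another e/(8C) keeps [C * W s] at most e/4
   near [s0]. *)
have [|c c0 cutc] := @cut_small s0 (e / (8 * C)).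
  by rewrite divr_gt0// mulr_gt0.
pose h t := F s0 t / Num.max (r t) c.
have ch : continuous h by exact: continuous_quot.
have Ch : C_b D h.
  split; first exact: continuous_subspaceT.
  exists C; split; first exact: num_real.
  move=> M CM t Dt; apply: le_trans (ltW CM).
  have m0 := max_gt0 t c0.
  rewrite normrM normfV (gtr0_norm m0) ler_pdivrMr//.
  apply: le_trans (FC t Dt) _; rewrite ler_pM2l// le_max lexx//.
have cHs := @cont_mu h Ch s0.
have bounded1 (g : T -> R) : continuous g -> (forall t, 0 <= g t <= 1) ->
    C_b D g.
  move=> cg g01; split; first exact: continuous_subspaceT.
  exists 1; split; first exact: num_real.
  move=> M M1 t Dt; apply: le_trans (ltW M1).
  by have /andP[? ?] := g01 t; rewrite ger0_norm.
(* The test functions 1 and [k] make the total mass [N] and the loss [W] continuous in [s], since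
   [k * r = cut c]. *)
have /cont_mu cN : C_b D (fun=> 1 : R).
  by apply: bounded1; [exact: cst_continuous|rewrite ler01 lexx].
pose k t := 1 - r t / Num.max (r t) c.
have /cont_mu cW : C_b D k.
  apply: bounded1 => t; last by have := ratio_le1 t c0; rewrite /k; lra.
  apply: cvgB; first exact: cst_continuous.
  exact: continuous_quot.
have kcut t : k t * r t = cut c t by rewrite /k /cut; ring.
have intr s : (mu s).-integrable D (EFin \o r).
  by apply: (@integrable_dominated _ _ 1) => // t _; rewrite ger0_norm ?mul1r.
have intcut s : (mu s).-integrable D (EFin \o cut c).
  apply: (@integrable_dominated _ _ 1); first exact: continuous_cut.
  by move=> t _; rewrite ger0_norm ?mul1r ?cut_le ?cut_ge0.
have inth s : (mu s).-integrable D (EFin \o (fun t => h t * r t)).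
  apply: (@integrable_dominated _ _ C).
    by move=> t; apply: cvgM; [exact: ch|exact: cr].
  move=> t Dt; rewrite /h mulrAC -mulrA normrM.
  have /andP[q0 q1] := ratio_le1 t c0; rewrite (ger0_norm q0).
  by apply: le_trans (FC t Dt); rewrite ler_piMr.
pose N s := \int[mu s]_(t in D) r t; pose W s := \int[mu s]_(t in D) cut c t.
pose H s := \int[mu s]_(t in D) (h t * r t).
have N0 s : 0 <= N s by apply: Rintegral_ge0.
have key s eta : 0 <= eta ->
    (forall t, D t -> `|F s t - F s0 t| <= eta * r t) ->
    `|\int[mu s]_(t in D) F s t - H s| <= eta * N s + C * W s.
  move=> eta0 Heta.
  have inte : (mu s).-integrable D (EFin \o (fun t => eta * r t)).
    exact: (integrableZl mD eta (intr s)).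
  have intC : (mu s).-integrable D (EFin \o (fun t => C * cut c t)).
    exact: (integrableZl mD C (intcut s)).
  have -> : eta * N s + C * W s
      = \int[mu s]_(t in D) (eta * r t + C * cut c t).
    by rewrite RintegralD// !RintegralZl.
  apply: le_dist_Rintegral => //; first exact: kernel_integrable.
    exact: (integrableD mD inte intC).
  move=> t Dt.
  (* Here [h * r = F s0 * (1 - k)]. The first term is at most [eta * r], the second at most
     [C * r * k = C * cut c]. *)
  have -> : F s t - h t * r t = (F s t - F s0 t) + F s0 t * k t.
    by rewrite /h /k; ring.
  apply: le_trans (ler_normD _ _) _; apply: lerD; first exact: Heta.
  have k0 : 0 <= k t by have := ratio_le1 t c0; rewrite /k; lra.
  by rewrite normrM (ger0_norm k0) -kcut mulrCA [leRHS]mulrC ler_wpM2r// FC.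
have key0 := key s0 0 (lexx 0).
(* Near [s0] the mass [N s] is at most [N s0 + 1], so [eta * N s] is at most e/4. *)
pose eta := e / (4 * (N s0 + 1)).
have Np : 0 < N s0 + 1 by rewrite ltr_wpDl.
have eta0 : 0 < eta by rewrite divr_gt0// mulr_gt0.
have {}key0 : `|\int[mu s0]_(t in D) F s0 t - H s0| <= e / 8.
  apply: le_trans (key0 _) _ => [t Dt|].
    by rewrite subrr normr0 mul0r.
  rewrite mul0r add0r -ler_pdivlMl//; apply: le_trans cutc _.
  by rewrite le_eqVlt; apply/orP; left; apply/eqP; field; rewrite gt_eqF.
near=> s.
have uns : forall t, D t -> `|F s t - F s0 t| <= eta * r t.
  by near: s; exact: unif_F.
have Ns : N s <= N s0 + 1.
  have : `|N s0 - N s| <= 1.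
    near: s; move/cvgrPdist_le : (cN s0) => /(_ 1 ltr01).
    by apply: filterS => s; under eq_Rintegral do rewrite mul1r;
       under [X in _ - X]eq_Rintegral do rewrite mul1r.
  by rewrite ler_norml; lra.
have Ws : C * W s <= e / 4.
  have : `|W s0 - W s| <= e / (8 * C).
    near: s; move/cvgrPdist_le : (cW s0) => /(_ (e / (8 * C))).
    rewrite divr_gt0 ?mulr_gt0// => /(_ isT); apply: filterS => s.
    by under eq_Rintegral do rewrite kcut;
       under [X in _ - X]eq_Rintegral do rewrite kcut.
  rewrite ler_norml => /andP[+ _] => ws.
  have W2 : W s <= 2 * (e / (8 * C)) by move: cutc ws; rewrite -/(W s0); lra.
  apply: (@le_trans _ _ (C * (2 * (e / (8 * C))))); first by rewrite ler_pM2l.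
  by rewrite le_eqVlt; apply/orP; left; apply/eqP; field; rewrite gt_eqF.
have Hs : `|H s0 - H s| <= e / 4.
  by near: s; move/cvgrPdist_le : cHs; apply; rewrite divr_gt0.
have := key s eta (ltW eta0) uns.
have : eta * N s <= e / 4.
  have -> : e / 4 = eta * (N s0 + 1) by rewrite /eta; field; rewrite gt_eqF.
  by rewrite ler_pM2l.
(* The total is e/8 at [s0], e/4 for the change of [H], and e/4 + e/4 at [s]: 7e/8 in all. *)
move: key0 Hs Ws; rewrite !ler_norml.
set I0 := \int[mu s0]_(t in D) F s0 t; set I1 := \int[mu s]_(t in D) F s t.
by lra.
Unshelve. all: by end_near. Qed.

End KernelContinuity.

Lemma continuous_sum (R : realType) (T : topologicalType) n
    (F : 'I_n -> T -> R) :
  (forall i, continuous (F i)) -> continuous (fun t => \sum_i F i t).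
Proof.
move=> cF; apply: continuous_big => [|i _]; last exact: cF.
exact: add_continuous.
Qed.

(** * The integral term *)

Section LevyIntegral.
Variables (R : realType) (d : nat) (G : lieGroupType R d).
Variable expo : ((G -> R) -> (G -> R)) -> G.
Hypothesis hexpo : exponential_map expo.
Variable X : 'I_d -> (G -> R) -> (G -> R).
Hypothesis lX : forall i, lie_algebra (X i).
Variables (U : set G) (x : 'I_d -> G -> R).
Hypothesis hU : canonical_nbhd expo X U x.

(** A point of [U] with some nonzero coordinate lies in the support of that coordinate; one with all
    coordinates zero is [e], as the chart is injective on [U]. *)
Lemma canonical_nbhd_precompact : exists2 L, compact L & U `<=` L.
Proof.
have [[_ U1] Cx [psi [[_ _ psiK _ _] _]] x1 _] := hU.
exists ([set 1%g] `|` \big[setU/set0]_(i < d) closure [set p | x i p != 0]).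
  apply: compactU; first exact: compact_set1.
  by apply: bigsetU_compact => i _; have [] := Cx i.
move=> g Ug; have [[i xi]|x0] := pselect (exists i, x i g != 0).
  right; rewrite (bigD1 i)//=; left; exact: subset_closure.
left; rewrite /= -(psiK _ Ug) -(psiK _ U1) /=; congr psi.
apply/rowP => i; rewrite !mxE x1; apply: contrapT => /eqP xi.
by apply: x0; exists i.
Qed.

Let cx i : continuous (x i).
Proof. by have [_ /(_ i)[sx _] _ _ _] := hU; exact: smooth_continuous. Qed.

Let r t := \sum_i x i t ^+ 2.

Let cr : continuous r.
Proof.
apply: continuous_sum => i t.
by apply: (@continuous_comp _ _ _ (x i) (fun u : R => u ^+ 2));
  [exact: cx|exact: exprn_continuous].
Qed.

Let r0 t : 0 <= r t. Proof. by apply: sumr_ge0 => i _; exact: sqr_ge0. Qed.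

Let x_bounded : exists C, forall i t, `|x i t| <= C i :> R.
Proof.
have bd i : exists C, forall t, `|x i t| <= C :> R.
  have [_ /(_ i)[sx xK] _ _ _] := hU.
  apply: (compact_support_bounded (cx (i := i)) xK).
  exact: notin_closure_support.
by exists (fun i => sval (cid (bd i))) => i; exact: (svalP (cid (bd i))).
Qed.

Variable f : G -> R.
Hypothesis f_Cc : Cc_infty f.
Let K := closure [set p | f p != 0].

Let sf : smooth f. Proof. by case: f_Cc. Qed.
Let cK : compact K. Proof. by case: f_Cc. Qed.
Let clK : closed K. Proof. exact: closed_closure. Qed.

Let sX i g : smooth g -> smooth (X i g).
Proof. by have [+ _ _ _ _] := lX i; exact. Qed.

Let f0 s : ~ K s -> f s = 0. Proof. exact: notin_closure_support. Qed.

Let Xf0 i s : ~ K s -> X i f s = 0.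
Proof. by move: s; exact: (lie_algebra_support hexpo (lX i) sf clK f0). Qed.

Let XXf0 i j s : ~ K s -> X i (X j f) s = 0.
Proof.
move: s; apply: (@lie_algebra_support _ _ _ _ hexpo _ (X j f) K) => //.
- exact: sX.
- exact: Xf0.
Qed.

Let XXf_bounded : exists C, forall i j t, `|X i (X j f) t| <= C.
Proof.
have bd i j : exists C, forall t, `|X i (X j f) t| <= C.
  apply: (compact_support_bounded _ cK); last exact: XXf0.
  by apply: smooth_continuous; apply: sX; exact: sX.
pose C i j := sval (cid (bd i j)).
exists (\sum_i \sum_j `|C i j|) => i j t.
apply: le_trans (svalP (cid (bd i j)) t) _; rewrite -/(C i j).
rewrite (bigD1 i)//= (bigD1 j)//= -addrA; apply: le_trans (ler_norm _) _.
rewrite lerDl addr_ge0 ?sumr_ge0// => k _; exact: sumr_ge0.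
Qed.

Definition jump s t := f (s * t)%g - f s - \sum_i x i t * X i f s.

Let cjump s : continuous (jump s).
Proof.
move=> t; apply: cvgB; last first.
  apply: continuous_sum => i {}t.
  by apply: cvgM; [exact: cx|exact: cst_continuous].
apply: cvgB; last exact: cst_continuous.
apply: (@continuous_comp _ _ _ (fun t => s * t)%g f).
  by apply: (@continuous_mulg _ _ G _ (cst s) id); [exact: cst_continuous|].
exact: smooth_continuous sf _.
Qed.

Let canonical_expo t : U t -> t = expo (\sum_i x i t *: X i).
Proof. by have [_ _ _ _ /(_ t)] := hU. Qed.

Let jump_U s : exists C, forall t, U t -> `|jump s t| <= C * r t.
Proof.
have [C HC] := XXf_bounded; exists (C * d%:R ^+ 2) => t Ut.
have := @taylor_translates _ _ _ _ hexpo _ lX f (x^~ t) 1 0 s s t C sf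
  (canonical_expo Ut).
under eq_bigr do rewrite mul0r subr0 mul1r.
rewrite !mul0r !mul1r !subr0; apply => i j u.
by rewrite mul0r mul1r subr0.
Qed.

Let jump_U_near s (e : R) : 0 < e ->
  \forall s' \near s, forall t, U t -> `|jump s' t - jump s t| <= e * r t.
Proof.
(* The Taylor bound carries the factor d^2; adding 1 keeps the denominator positive when d = 0. *)
move=> e0; pose eta := e / (d%:R ^+ 2 + 1).
have D0 : 0 < d%:R ^+ 2 + 1 :> R by rewrite ltr_wpDl// sqr_ge0.
have eta0 : 0 < eta by rewrite divr_gt0.
have : \forall s' \near s, forall ij : 'I_d * 'I_d, forall t,
    `|X ij.1 (X ij.2 f) (s' * t)%g - X ij.1 (X ij.2 f) (s * t)%g| <= eta.
  apply: filter_forall => -[i j] /=.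
  apply: (@translate_equicontinuous _ _ _ _ K) => //; last exact: XXf0.
  by apply: smooth_continuous; apply: sX; exact: sX.
apply: filterS => s' near_s t Ut.
have := @taylor_translates _ _ _ _ hexpo _ lX f (x^~ t) 1 1 s' s t eta sf
  (canonical_expo Ut).
rewrite !mul1r => H.
have -> : jump s' t - jump s t = f (s' * t)%g - f (s * t)%g - (f s' - f s)
    - \sum_i x i t * (1 * X i f s' - 1 * X i f s).
  rewrite /jump; under [X in _ = _ - X]eq_bigr do rewrite !mul1r mulrBr.
  rewrite sumrB; ring.
apply: le_trans (H _) _ => [i j u|].
  by rewrite !mul1r; exact: (near_s (i, j)).
apply: ler_wpM2r; first exact: r0.
rewrite /eta mulrAC ler_pdivrMr// ler_pM2l// lerDl ler01//.
Qed.

(* The factor 1 is the weight [r] of [KernelContinuity]. *)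
Let jump_UC s : exists C, forall t, (~` U) t -> `|jump s t| <= C * 1.
Proof.
have [C HC] := compact_support_bounded (smooth_continuous sf) cK f0.
have [D HD] := x_bounded.
exists (C + C + \sum_i D i * `|X i f s|) => t _; rewrite mulr1.
apply: le_trans (ler_normB _ _) _; apply: lerD.
  by apply: le_trans (ler_normB _ _) _; apply: lerD; exact: HC.
apply: le_trans (ler_norm_sum _ _ _) _; apply: ler_sum => i _.
by rewrite normrM ler_wpM2r.
Qed.

(** Off [U] no second-order gain is needed. The translate of [f], its value at the base point and
    the first-order sum each move by at most e/3, the last because the [x i] are bounded on all of
    [G]. *)
Let jump_UC_near s (e : R) : 0 < e ->
  \forall s' \near s, forall t, (~` U) t -> `|jump s' t - jump s t| <= e * 1.
Proof.
move=> e0; have e30 : 0 < e / 3 by rewrite divr_gt0.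
have [D HD] := x_bounded.
have near1 : \forall s' \near s, forall t,
    `|f (s' * t)%g - f (s * t)%g| <= e / 3.
  apply: (@translate_equicontinuous _ _ _ _ K) => //.
  exact: smooth_continuous.
have near2 : \forall s' \near s, `|f s' - f s| <= e / 3.
  have := smooth_continuous sf (x := s) => /cvgr_distC_le; exact.
have near3 : \forall s' \near s,
    \sum_i D i * `|X i f s' - X i f s| <= e / 3.
  have c3 : continuous (fun s' => \sum_i D i * `|X i f s' - X i f s|).
    apply: continuous_sum => i u; apply: cvgM; first exact: cst_continuous.
    apply: cvg_norm; apply: cvgB; last exact: cst_continuous.
    by apply: smooth_continuous; exact: sX.
  have := @cvgr_norm_le _ _ _ _ _ _ _ (c3 s) (e / 3).
  rewrite /= big1 ?normr0 => [|i _]; last by rewrite subrr normr0 mulr0.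
  move=> /(_ _ e30); apply: filterS => u; exact/le_trans/ler_norm.
apply: filterS3 near1 near2 near3 => s' n1 n2 n3 t _; rewrite mulr1.
have -> : jump s' t - jump s t = (f (s' * t)%g - f (s * t)%g) - (f s' - f s)
    - \sum_i x i t * (X i f s' - X i f s).
  rewrite /jump; under [X in _ = _ - X]eq_bigr do rewrite mulrBr.
  rewrite sumrB; ring.
have n3' : `|\sum_i x i t * (X i f s' - X i f s)| <= e / 3.
  apply: le_trans n3; apply: le_trans (ler_norm_sum _ _ _) _.
  by apply: ler_sum => i _; rewrite normrM ler_wpM2r.
have := n1 t; move: n2 n3'; rewrite !ler_norml; lra.
Qed.

Variable mu : G -> {measure set (borel G) -> \bar R}.
Hypothesis mu_levy : forall s, levy_measure expo X (mu s).
Hypothesis mu_U_cont : forall h : G -> R, C_b U h ->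
  continuous (fun g : G => \int[mu g]_(t in U) (h t * \sum_i x i t ^+ 2)).
Hypothesis mu_UC_cont : forall k : G -> R, C_b (~` U) k ->
  continuous (fun g : G => \int[mu g]_(t in ~` U) k t).

Let mU : measurable (U : set (borel G)).
Proof. by have [[oU _] _ _ _ _] := hU; exact: sub_sigma_algebra. Qed.

Let mUC : measurable (~` U : set (borel G)). Proof. exact: measurableC. Qed.

Let finU s : (\int[mu s]_(t in U) (r t)%:E < +oo)%E.
Proof. by have [_ /(_ U x hU)[]] := mu_levy s. Qed.

Let finUC s : (\int[mu s]_(t in ~` U) (1%:E) < +oo)%E.
Proof.
by rewrite integral_cst// mul1e; have [_ /(_ U x hU)[]] := mu_levy s.
Qed.

Lemma jump_integral_U_continuous :
  continuous (fun s => \int[mu s]_(t in U) jump s t).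
Proof. exact: (kernel_integral_continuous mU cr r0 finU). Qed.

Lemma jump_integral_UC_continuous :
  continuous (fun s => \int[mu s]_(t in ~` U) jump s t).
Proof.
apply: (@kernel_integral_continuous _ _ _ _ _ (fun=> 1) mUC) => //.
  exact: cst_continuous.
move=> h Ch; have := mu_UC_cont Ch.
by under eq_fun do under eq_Rintegral do rewrite -[h _]mulr1.
Qed.

(** The jump integrand is integrable on both pieces, so the extended real integral is finite and no
    real integral on the right takes the default value 0 of an infinite one. *)
Lemma jump_integral_split s :
  (\int[mu s]_t (jump s t)%:E)%E
  = (\int[mu s]_(t in U) jump s t + \int[mu s]_(t in ~` U) jump s t)%:E.
Proof.
have intU : (mu s).-integrable U (EFin \o jump s).
  exact: (kernel_integrable mU cr r0 finU cjump jump_U).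
have intUC : (mu s).-integrable (~` U) (EFin \o jump s).
  apply: (@kernel_integrable _ _ _ _ _ (fun=> 1) mUC _ _ finUC) => //.
  exact: cst_continuous.
rewrite -(setUv U) integral_setU//.
- by rewrite EFinD /Rintegral !fineK//; exact: integrable_fin_num.
- by apply/measurable_EFinP; apply: continuous_borel_measurable; exact: cjump.
- by apply/disj_setPS; rewrite setICr.
Qed.

Hypothesis mu_infty :
  (fun s => mu s (~` U)) @ @at_infinity G --> (0%E : \bar R).

Lemma jump_integral_infty :
  \int[mu s]_(t in U) jump s t + \int[mu s]_(t in ~` U) jump s t
    @[s --> @at_infinity G] --> (0 : R).
Proof.
have [C HC] := compact_support_bounded (smooth_continuous sf) cK f0.
have C0 : 0 <= C by exact: le_trans (HC 1%g).
have [L cL UL] := canonical_nbhd_precompact.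
(* If [s t] lies in [K] with [t] in [L], then [s] lies in K L^-1; off this compact set [f (s t)]
   vanishes for every [t] in [U]. *)
pose KL := (fun p : G * G => p.1 * p.2^-1)%g @` (K `*` L).
have cKL : compact KL.
  apply: continuous_compact; last exact: compact_setX.
  apply: continuous_subspaceT => p.
  apply: continuous_mulg; first exact: cvg_fst.
  by apply: continuous_invg; exact: cvg_snd.
have far : \forall s \near @at_infinity G, ~ (K `|` KL) s.
  by exists (K `|` KL) => //; exact: compactU.
apply/cvgrPdist_le => e e0.
(* [C + 1] rather than [C], as [C] may be 0. *)
move/fine_cvgP : mu_infty => [_ /cvgrPdist_le/(_ (e / (C + 1)))].
rewrite divr_gt0 ?ltr_wpDl// => /(_ isT) small.
apply: filterS2 far small => s /not_orP[nKs nKLs] /=.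
have jumpE t : jump s t = f (s * t)%g.
  by rewrite /jump (f0 nKs) big1 => [|i _]; rewrite ?subr0// Xf0// mulr0.
have -> : \int[mu s]_(t in U) jump s t = 0.
  rewrite (@eq_Rintegral _ _ _ _ _ (fun=> 0)) ?Rintegral_cst// ?mul0r//.
  move=> t; rewrite inE => Ut; rewrite jumpE f0// => Kst; apply: nKLs.
  exists (s * t, t)%g => /=; last by rewrite mulgK.
  by split => //=; exact: UL.
rewrite !sub0r !normrN add0r => small.
apply: le_trans (_ : _ <= C * fine (mu s (~` U))) _.
  rewrite -Rintegral_cst//.
  (* Subtracting 0, written as the integral of the zero function, brings the bound under
     [le_dist_Rintegral]. *)
  rewrite -[X in `|X|]subr0 -[X in _ - X](mul0r (fine (mu s (~` U)))).
  rewrite -(Rintegral_cst _ mUC 0); apply: le_dist_Rintegral => //.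
  - apply: (@kernel_integrable _ _ _ _ _ (fun=> 1) mUC _ _ finUC) => //.
    exact: cst_continuous.
  - apply: (@integrable_dominated _ _ _ _ _ (fun=> 1) mUC _ _ finUC _ _ 0)
      => //.
    + exact: cst_continuous.
    + exact: cst_continuous.
    + by move=> t _; rewrite normr0 mul0r.
  - apply: (@integrable_dominated _ _ _ _ _ (fun=> 1) mUC _ _ finUC _ _ C)
      => //.
    + exact: cst_continuous.
    + exact: cst_continuous.
    + by move=> t _; rewrite mulr1 ger0_norm.
  - by move=> t _; rewrite subr0 jumpE.
have C1 : 0 < C + 1 by rewrite ltr_wpDl.
move: small; rewrite ger0_norm ?fine_ge0// ler_pdivlMr// mulrC; apply: le_trans.
by rewrite ler_wpM2r ?fine_ge0// lerDl.
Qed.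

End LevyIntegral.

(** * Continuity of [A f] and its decay at infinity *)

Theorem corollary3p9 (R : realType) (d : nat) (G : lieGroupType R d)
  (expo : ((G -> R) -> (G -> R)) -> G) (hexpo : exponential_map expo)
  (X : 'I_d -> (G -> R) -> (G -> R)) (hX : lie_algebra_basis X)
  (U : set G) (x : 'I_d -> G -> R) (hU : canonical_nbhd expo X U x)
  (A : (G -> R) -> (G -> R))
  (A_linear : linear_on (@Cc_infty R d G) A)
  (A_pmp : positive_maximum_principle A)
  (c : G -> R) (b : 'I_d -> G -> R) (a : G -> 'M[R]_d)
  (mu : G -> {measure set (borel G) -> \bar R})
  (c_ge0 : forall s, 0 <= c s)
  (a_sym : forall s, (a s)^T = a s)
  (a_nneg : forall s (v : 'I_d -> R),
     0 <= \sum_j \sum_k v j * a s j k * v k)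
  (mu_levy : forall s, levy_measure expo X (mu s))
  (A_formula : forall f, Cc_infty f -> forall s : G,
     (A f s)%:E =
       ((- c s * f s + \sum_i b i s * X i f s
         + \sum_j \sum_k a s j k * X j (X k f) s)%:E
        + \int[mu s]_t (f (s * t)%g - f s - \sum_i x i t * X i f s)%:E)%E)
  (a_cont : forall i j, continuous (fun s => a s i j))
  (b_cont : forall i, continuous (b i))
  (c_cont : continuous c)
  (mu_U_cont : forall h : G -> R, C_b U h ->
     continuous (fun g : G =>
       \int[mu g]_(t in U) (h t * \sum_i x i t ^+ 2)))
  (mu_UC_cont : forall k : G -> R, C_b (~` U) k ->
     continuous (fun g : G => \int[mu g]_(t in ~` U) k t))
  (mu_infty : (fun s => mu s (~` U)) @ @at_infinity G --> (0%E : \bar R)) :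
  forall f, Cc_infty f -> C_0 (A f).
Proof.
move=> f f_Cc; have [lX _ _] := hX; have [sf cK] := f_Cc.
have sX i g : smooth g -> smooth (X i g) by have [+ _ _ _ _] := lX i; exact.
pose loc s := - c s * f s + \sum_i b i s * X i f s
  + \sum_j \sum_k a s j k * X j (X k f) s.
pose jmp s := \int[mu s]_(t in U) jump X x f s t
  + \int[mu s]_(t in ~` U) jump X x f s t.
(* The formula for [A] is an identity in the extended reals; finiteness of the jump integral turns
   it into a real one. *)
have AfE : A f = (fun s => loc s + jmp s).
  apply/funext => s; apply: EFin_inj.
  by rewrite A_formula// (jump_integral_split hexpo lX hU f_Cc mu_levy) EFinD.
split.
  rewrite AfE => s; apply: cvgD; last first.
    apply: cvgD.
      exact: (jump_integral_U_continuous hexpo lX hU f_Cc mu_levy mu_U_cont).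
    exact: (jump_integral_UC_continuous lX hU f_Cc mu_levy mu_UC_cont).
  apply: cvgD; first apply: cvgD.
  - by apply: cvgM; [apply: cvgN; exact: c_cont|exact: smooth_continuous].
  - apply: continuous_sum => i u; apply: cvgM; first exact: b_cont.
    by apply: smooth_continuous; exact: sX.
  - apply: continuous_sum => j; apply: continuous_sum => k u.
    apply: cvgM; first exact: a_cont.
    by apply: smooth_continuous; apply: (sX j); exact: (sX k).
have clK : closed (closure [set p | f p != 0]) by exact: closed_closure.
have f0 := @notin_closure_support R G f.
have Xf0 i := lie_algebra_support hexpo (lX i) sf clK f0.
(* Off the support of [f] the functions f, X_i f and X_j X_k f all vanish, so near infinity only the
   jump part remains, whatever the growth of the coefficients. *)
have loc0 : \forall s \near @at_infinity G, jmp s = A f s.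
  exists (closure [set p | f p != 0]) => // s nKs.
  rewrite AfE /loc f0// mulr0 add0r big1 => [|i _]; last by rewrite Xf0 ?mulr0.
  rewrite add0r big1 ?add0r// => j _; rewrite big1// => k _.
  by rewrite (lie_algebra_support hexpo (lX j) (sX k f sf) clK (Xf0 k)) ?mulr0.
apply: cvg_trans (near_eq_cvg loc0) _.
exact: (jump_integral_infty hexpo lX hU f_Cc mu_levy mu_infty).
Qed.
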